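(* Let $q$ be a prime power and let $M$ be a spike of rank $n>q^3$ with ground set $E$. If $\mathcal{X}$ is a collection of subsets of $E$ such that every matroid $N$ on $E$ with $r_N(X)=r_M(X)$ for all $X\in\mathcal{X}$ is $GF(q)$-representable, then $|\mathcal{X}|\ge 2^{n/2}$. That is, proving that $M$ is $GF(q)$-representable requires at least $2^{n/2}$ rank values.
   Context: Let $n\ge 3$. Let $N$ be a rank-$n$ matroid with ground set $\{t,a_1,b_1,\dots,a_n,b_n\}$ such that (i) $\{t,a_i,b_i\}$ is a triangle (3-element circuit) for every $i\in\{1,\dots,n\}$, and (ii) $r(\bigcup_{j\in J}\{a_j,b_j\})=|J|+1$ for every nonempty proper subset $J$ of $\{1,\dots,n\}$. Then $M=N\setminus t$ is called a rank-$n$ spike, and the pairs $\{a_i,b_i\}$ are its legs. A rank value/rank evaluation is the value $r_M(X)$ for a subset $X$. *)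

(* Defs.v *)
From HB Require Import structures.
From mathcomp Require Import all_boot all_order all_algebra.

Set Implicit Arguments.
Unset Strict Implicit.
Unset Printing Implicit Defensive.

(** Matroids have an explicit ground set inside an ambient finite type, so that
    deletion does not change the type.  The axioms are boolean, so a matroid is
    determined by its ground set and its independent sets. *)

Definition matroid_axioms (T : finType) (E : {set T}) (Is : {set {set T}}) : bool :=
  [&& [forall I in Is, I \subset E],
      set0 \in Is,
      [forall J in Is, forall I : {set T}, (I \subset J) ==> (I \in Is)]
    & [forall I in Is, forall J in Is,
        (#|I| < #|J|) ==> [exists x in J :\: I, x |: I \in Is]]].

Record matroid (T : finType) := Matroid {
  ground : {set T};
  indep : {set {set T}};
  matroidP : matroid_axioms ground indep }.

Definition rank (T : finType) (M : matroid T) (X : {set T}) : nat :=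
  \max_(I in indep M | I \subset X) #|I|.

Definition circuit (T : finType) (M : matroid T) (C : {set T}) : bool :=
  minset (fun D : {set T} => (D \subset ground M) && (D \notin indep M)) C.

Definition triangle (T : finType) (M : matroid T) (C : {set T}) : bool :=
  circuit M C && (#|C| == 3).

Lemma delete_axioms (T : finType) (M : matroid T) (t : T) :
  matroid_axioms (ground M :\ t) [set I in indep M | t \notin I].
Proof.
case: M => E Is /= /and4P[/forall_inP sE I0 /forall_inP her /forall_inP aug].
apply/and4P; split.
- apply/forall_inP => I; rewrite inE => /andP[II tI].
  by rewrite subsetD1 sE.
- by rewrite inE I0 inE.
- apply/forall_inP => J; rewrite inE => /andP[JI tJ].
  apply/forallP => I; apply/implyP => sIJ; rewrite inE.
  have /forallP/(_ I)/implyP/(_ sIJ) -> /= := her J JI.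
  by apply: contra tJ; apply: (subsetP sIJ).
- apply/forall_inP => I; rewrite inE => /andP[II tI].
  apply/forall_inP => J; rewrite inE => /andP[JI tJ].
  apply/implyP => ltIJ.
  have /forall_inP/(_ J JI)/implyP/(_ ltIJ)/exists_inP[x xJI xI] := aug I II.
  apply/exists_inP; exists x => //; rewrite inE xI /= in_setU1 negb_or tI andbT.
  by apply: contra tJ => /eqP->; move: xJI; rewrite inE => /andP[].
Qed.

Definition delete (T : finType) (M : matroid T) (t : T) : matroid T :=
  Matroid (delete_axioms M t).

Definition spike (T : finType) (n : nat) (M : matroid T) : Prop :=
  2 < n /\
  exists (N : matroid T) (t : T) (a b : 'I_n -> T),
    [/\ uniq (t :: codom a ++ codom b),
        ground N = [set x in t :: codom a ++ codom b],
        rank N (ground N) = n,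
        (forall i : 'I_n, triangle N [set t; a i; b i]) /\
        (forall J : {set 'I_n}, J != set0 -> J \proper [set: 'I_n] ->
           rank N (\bigcup_(j in J) [set a j; b j]) = #|J| + 1)
      & M = delete N t].

(** [free] is applied to the family indexed by [I], so parallel elements, which
    may be represented by equal vectors, are dependent. *)
Definition representable (F : fieldType) (T : finType) (M : matroid T) : Prop :=
  exists (m : nat) (v : T -> 'cV[F]_m),
    forall I : {set T}, I \subset ground M ->
      (I \in indep M) = free [seq v e | e in I].

(* Main.v *)
(* Up to relabelling, a rank-n spike is determined by its set D of dependent
   transversals, and every D without two transversals differing in exactly one
   leg occurs.  A representation over F determines a common point t of the lines
   spanned by the legs; the coordinates relative to t give d_1, ..., d_n and s in
   F such that a transversal x lies in D iff the sum of the d_i with x_i true is s.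

   Given two such systems (d, s), (d', s') and a transversal x, swapping leg i of x
   changes the two sums by (d_i, d'_i) or (-d_i, -d'_i), according to x_i.  Since
   n > q^3, this pair of changes is the same for some q legs; as q F = 0, swapping
   these legs preserves both sums.  Hence a representable spike M with x in D never stays
   representable when x is removed from D, because the swapped transversal stays
   dependent; likewise, if D is empty, no single x may be added to it.  Since such
   a change affects only the rank of x itself, every x in D (every x at all, if D
   is empty) must belong to the certificate.

   Finally D is the solution set of a subset-sum equation in a group of order q,
   so if nonempty it has at least 2^(n-q) elements, and q <= n/2. *)
Require Import Defs.
From HB Require Import structures.
From mathcomp Require Import all_boot all_order all_algebra.
From mathcomp Require Import zify.
From mathcomp Require Import reals exp.

Set Implicit Arguments.
Unset Strict Implicit.
Unset Printing Implicit Defensive.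

Import Order.TTheory GRing.Theory Num.Theory.

(** * Spikes from their dependent transversals *)

Definition flip (I : finType) (x : {ffun I -> bool}) (A : {set I}) :
    {ffun I -> bool} := [ffun i => x i (+) (i \in A)].

Section Spike.
Variable n : nat.
Implicit Types (P Q : {set 'I_n * bool}) (x y : {ffun 'I_n -> bool}).
Implicit Types D : {set {ffun 'I_n -> bool}}.

(* Leg i consists of (i, false) and (i, true), and D collects the dependent
   transversals.  The only other bases contain both elements of some leg i, no
   element of some leg j, and one element of every remaining leg. *)
Definition transversal_of x : {set 'I_n * bool} := [set e | e.2 == x e.1].

Definition mixed_basis (i j : 'I_n) x : {set 'I_n * bool} :=
  [set e | (e.1 != j) && ((e.1 == i) || (e.2 == x e.1))].

Definition spike_indep D : {set {set 'I_n * bool}} :=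
  [set P : {set 'I_n * bool} |
     [exists i, exists j, exists x, (i != j) && (P \subset mixed_basis i j x)]
     || [exists x, (x \notin D) && (P == transversal_of x)]].

(** Augmentation demands this: a set with one element on every leg but [i] must extend to at least
    one independent transversal. *)
Definition nonadjacent D := forall x i, x \in D -> flip x [set i] \notin D.

Definition full_leg P i := ((i, false) \in P) && ((i, true) \in P).

Lemma full_legP P i : reflect (forall c, (i, c) \in P) (full_leg P i).
Proof.
apply: (iffP andP) => [[? ?] []//|h]; by split; apply: h.
Qed.

(** Lying in a mixed basis means missing leg [j] and filling no leg but [i]; [x] then only records
    the element of [P], if any, on each other leg. *)
Lemma spike_indepP D P :
  reflect ((exists i j, [/\ i != j, forall c, (j, c) \notin P
                          & forall l, full_leg P l -> l = i])
           \/ (exists2 x, x \notin D & P = transversal_of x))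
          (P \in spike_indep D).
Proof.
rewrite inE; apply: (iffP orP) => -[].
- move=> /existsP[i /existsP[j /existsP[x /andP[ij /subsetP sP]]]]; left.
  exists i, j; split=> // [c|l /full_legP h].
    by apply/negP => /sP; rewrite inE eqxx.
  have := sP _ (h (~~ x l)); rewrite inE /= => /andP[_ /orP[/eqP //|]].
  by case: (x l).
- by move=> /existsP[x /andP[xD /eqP eP]]; right; exists x.
- move=> [i [j [ij hj hi]]]; left.
  apply/existsP; exists i; apply/existsP; exists j.
  apply/existsP; exists [ffun l => (l, true) \in P]; rewrite ij /=.
  apply/subsetP => -[l c] lP; rewrite inE ffunE /=.
  apply/andP; split; first by apply: contraTneq lP => ->.
  case: eqP => //= nli; case: c lP => lP; first by rewrite lP.
  case: (boolP ((l, true) \in P)) => // lP'; case: nli; apply: hi.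
  by rewrite /full_leg lP lP'.
- by move=> [x xD ->]; right; apply/existsP; exists x; rewrite xD eqxx.
Qed.

Lemma mem_transversal x i c : ((i, c) \in transversal_of x) = (c == x i).
Proof. by rewrite inE. Qed.

Lemma transversal_inj : injective transversal_of.
Proof.
move=> x y /setP e; apply/ffunP => i.
by have := e (i, x i); rewrite !mem_transversal eqxx => /esym/eqP.
Qed.

Lemma transversal_full x i : ~~ full_leg (transversal_of x) i.
Proof. by rewrite /full_leg !mem_transversal; case: (x i). Qed.

Lemma transversal_indep D x :
  (transversal_of x \in spike_indep D) = (x \notin D).
Proof.
apply/spike_indepP/idP => [[[i [j [_ /(_ (x j))]]]|[y yD /transversal_inj ->]]//|].
  by rewrite mem_transversal eqxx.
by right; exists x.
Qed.

Lemma card_no_full_leg P : (forall l, ~~ full_leg P l) -> #|fst @: P| = #|P|.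
Proof.
move=> h; apply: card_in_imset => -[i c] [j e] /= iP jP eij.
move: jP; rewrite -eij => {j eij} jP; have := h i.
by case: c e iP jP => [] [] iP jP //; rewrite /full_leg iP jP.
Qed.

Lemma card_full_leg P i : full_leg P i -> #|fst @: P| < #|P|.
Proof.
case/andP => i0 i1; rewrite (cardsD1 (i, true) P) i1 ltnS.
rewrite -(_ : fst @: (P :\ (i, true)) = fst @: P) ?leq_imset_card //.
apply/eqP; rewrite eqEsubset imsetS ?subD1set //=.
apply/subsetP => _ /imsetP[[l c] lP ->] /=.
case: (altP ((l, c) =P (i, true))) => [[-> _]|ne].
  by apply/imsetP; exists (i, false) => //; rewrite !inE xpair_eqE andbF i0.
by apply/imsetP; exists (l, c) => //; rewrite !inE ne.
Qed.

(** Dropping [(i, true)] leaves at most one element on each leg. *)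
Lemma card_one_full_leg P i :
  (forall l, full_leg P l -> l = i) -> #|P| <= #|fst @: P|.+1.
Proof.
move=> h; rewrite (cardsD1 (i, true) P) -(@card_no_full_leg (P :\ _)); last first.
  move=> l; apply/negP => /full_legP f.
  have e : l = i.
    by apply/h/full_legP => c; have := f c; rewrite !inE => /andP[].
  by have := f true; rewrite e !inE eqxx.
rewrite -add1n leq_add ?leq_b1 //; apply: subset_leq_card.
by rewrite imsetS ?subD1set.
Qed.

Lemma card_transversal x : #|transversal_of x| = n.
Proof.
rewrite -(card_no_full_leg (transversal_full x)).
rewrite -[RHS]card_ord; apply: eq_card => i.
rewrite [RHS]inE; apply/imsetP; exists (i, x i) => //.
by rewrite mem_transversal.
Qed.

Lemma missing_leg P j : (forall c, (j, c) \notin P) -> #|fst @: P| < n.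
Proof.
move=> h; rewrite -[ltnRHS]card_ord; apply: (@leq_trans #|[set: 'I_n]|).
  apply: proper_card; rewrite properT; apply/negP => /eqP/setP/(_ j).
  by rewrite inE => /imsetP[[l c] lP /= e]; have := h c; rewrite e lP.
by rewrite cardsT.
Qed.

Lemma exists_missing_leg P :
  #|fst @: P| < n -> exists j, forall c, (j, c) \notin P.
Proof.
move=> h; have /existsP[j jP] : [exists j, j \notin fst @: P].
  apply: contraTT h; rewrite negb_exists => /forallP h; rewrite -leqNgt.
  rewrite -[leqLHS]card_ord; apply/subset_leq_card/subsetP => j _.
  by have := h j; rewrite negbK.
exists j => c; apply: contra jP => cP; by apply/imsetP; exists (j, c).
Qed.

Lemma spike_indep_card D P : P \in spike_indep D -> #|P| <= n.
Proof.
case/spike_indepP => [[i [j [ij hj hi]]]|[x _ ->]]; last by rewrite card_transversal.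
exact: leq_trans (card_one_full_leg hi) (missing_leg hj).
Qed.

Lemma spike_indep_one_full D P : 0 < n -> P \in spike_indep D ->
  exists i, forall l, full_leg P l -> l = i.
Proof.
move=> n0 /spike_indepP[[i [j [_ _ h]]]|[x _ ->]]; first by exists i.
by exists (Ordinal n0) => l; rewrite (negPf (transversal_full x l)).
Qed.

Lemma no_full_leg_indep D P : 1 < n -> #|fst @: P| < n ->
  (forall l, ~~ full_leg P l) -> P \in spike_indep D.
Proof.
move=> n1 /exists_missing_leg[j hj] h; apply/spike_indepP; left.
have [i ij] : exists i : 'I_n, i != j.
  have n0 : 0 < n by apply: ltnW.
  exists (if j == Ordinal n0 then Ordinal n1 else Ordinal n0).
  by case: (eqVneq j (Ordinal n0)) => [->|]; rewrite // eq_sym.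
by exists i, j; split=> // l; rewrite (negPf (h l)).
Qed.

Lemma one_full_leg_indep D P i : #|fst @: P| < n ->
  full_leg P i -> (forall l, full_leg P l -> l = i) -> P \in spike_indep D.
Proof.
move=> /exists_missing_leg[j hj] fi h; apply/spike_indepP; left.
exists i, j; split=> //; apply/eqP => e.
by move/andP: fi => [+ _]; rewrite e (negPf (hj _)).
Qed.

Lemma full_transversal P : (forall l, ~~ full_leg P l) -> n <= #|fst @: P| ->
  exists x, P = transversal_of x.
Proof.
move=> h hn; have legs l : exists c, (l, c) \in P.
  have : l \in fst @: P.
    suff -> : fst @: P = setT by rewrite inE.
    by apply/eqP; rewrite eqEcard subsetT cardsT card_ord.
  by case/imsetP => -[l' c] lP /= ->; exists c.
exists [ffun l => (l, true) \in P]; apply/setP => -[l c].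
rewrite mem_transversal ffunE; have := h l; have [[] lP] := legs l;
  rewrite /full_leg lP ?andbT /=; case: c => //=; first by move/negPf.
by move=> /negPf ->.
Qed.

Lemma card_legsU1 P e : #|fst @: (e |: P)| <= #|fst @: P|.+1.
Proof. rewrite imsetU1 cardsU1 -add1n leq_add2r; exact: leq_b1. Qed.

Lemma full_legU1 P i c l : full_leg ((i, c) |: P) l -> l != i -> full_leg P l.
Proof.
by move=> + nl; rewrite /full_leg !inE !xpair_eqE (negPf nl).
Qed.

Lemma spike_indep_sub D P Q :
  1 < n -> P \subset Q -> Q \in spike_indep D -> P \in spike_indep D.
Proof.
move=> n1 sPQ /spike_indepP[[i [j [ij hj hi]]]|[x xD eQ]].
  apply/spike_indepP; left; exists i, j; split=> // [c|l /full_legP f].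
    by apply: contra (hj c); apply: (subsetP sPQ).
  by apply/hi/full_legP => c; apply: (subsetP sPQ).
have h l : ~~ full_leg P l.
  apply: contra (transversal_full x l) => /full_legP f.
  by apply/full_legP => c; rewrite -eQ; apply: (subsetP sPQ).
have [lt|ge] := ltnP #|fst @: P| n; first exact: no_full_leg_indep.
suff -> : P = transversal_of x by rewrite transversal_indep.
apply/eqP; rewrite -eQ eqEcard sPQ /= eQ card_transversal.
by rewrite -(card_no_full_leg h).
Qed.

(** If [P] has a full leg, counting legs shows that [Q] meets a leg missed by [P], and an element
    there can be added. If [P] has none and meets every leg that [Q] meets, then [Q] has a full leg,
    which can be completed in [P]. Otherwise an element of [Q] on a leg missed by [P] works, unless
    it completes a dependent transversal. *)
Lemma spike_indep_aug D P Q : 1 < n -> nonadjacent D ->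
  P \in spike_indep D -> Q \in spike_indep D -> #|P| < #|Q| ->
  exists2 e, e \in Q :\: P & e |: P \in spike_indep D.
Proof.
move=> n1 nD iP iQ ltPQ; have n0 : 0 < n by lia.
have Qn := spike_indep_card iQ.
have [i hi] := spike_indep_one_full n0 iP; have [j hj] := spike_indep_one_full n0 iQ.
have leQ := card_one_full_leg hj.
have notin (R : {set 'I_n * bool}) l c : l \notin fst @: R -> (l, c) \notin R.
  by apply: contra => ?; apply/imsetP; exists (l, c).
have [/existsP[k fk]|] := boolP [exists k, full_leg P k].
  have ek := hi _ fk; subst k; have := card_full_leg fk => ltP.
  have /subsetPn[l] : ~~ (fst @: Q \subset fst @: P).
    by apply/negP => /subset_leq_card; lia.
  case/imsetP => -[l' c] lQ /= -> nlP; exists (l', c).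
    by rewrite inE lQ andbT notin.
  apply: (@one_full_leg_indep _ _ i).
  - by have := card_legsU1 P (l', c); lia.
  - by apply/full_legP => e; rewrite inE (full_legP _ _ fk) orbT.
  - move=> k fk'; have [ekl|nkl] := eqVneq k l'; last exact/hi/(full_legU1 fk').
    have /full_legP/(_ (~~ c)) := fk'; rewrite ekl !inE xpair_eqE.
    by rewrite (negPf (notin _ _ _ nlP)); case: (c); rewrite /= andbF.
rewrite negb_exists => /forallP nP; have eP := card_no_full_leg nP.
have [sl|/subsetPn[l]] := boolP (fst @: Q \subset fst @: P).
  have /existsP[k fk] : [exists k, full_leg Q k].
    apply: contraTT ltPQ; rewrite negb_exists => /forallP /card_no_full_leg.
    by have := subset_leq_card sl; lia.
  have kP : k \in fst @: P.
    by apply: (subsetP sl); apply/imsetP; exists (k, true); first by case/andP: fk.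
  have [[k' c] cP /= ek] := imsetP kP; subst k'.
  exists (k, ~~ c).
    rewrite inE (full_legP _ _ fk) andbT; apply: contra (nP k) => nc.
    by apply/full_legP => e; by case: c e cP nc => [] [].
  apply: (@one_full_leg_indep _ _ k).
  - by rewrite imsetU1 /= (setUidPr _) ?sub1set // eP; lia.
  - apply/full_legP => e; rewrite !inE xpair_eqE eqxx.
    by case: c e cP => [] [] cP; rewrite ?cP ?orbT.
  - by move=> m fm; apply/eqP; apply: contraT => /(full_legU1 fm); rewrite (negPf (nP m)).
case/imsetP => -[l' c] cQ /= -> {l} nlP; set l := l' in cQ nlP *.
have lQP e : (l, e) \in Q -> (l, e) \in Q :\: P by move=> eQ; rewrite inE eQ andbT notin.
have nU e m : ~~ full_leg ((l, e) |: P) m.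
  apply/negP => fm; have [em|nm] := eqVneq m l; last first.
    by have := full_legU1 fm nm; rewrite (negPf (nP m)).
  have /full_legP/(_ (~~ e)) := fm; rewrite em !inE xpair_eqE.
  by rewrite (negPf (notin _ _ _ nlP)); case: (e); rewrite /= andbF.
have [lt|ge] := ltnP #|fst @: ((l, c) |: P)| n.
  by exists (l, c); [exact: lQP | exact: no_full_leg_indep].
have [x ex] := full_transversal (nU c) ge.
have [xD|xD] := boolP (x \in D); last first.
  by exists (l, c); [exact: lQP | rewrite ex transversal_indep].
have exl : c = x l.
  by apply/eqP; rewrite -mem_transversal -ex !inE eqxx.
(* Adding [(l, c)] gives the dependent transversal [x]. If [Q] also offers the other element of leg
   [l], that one gives the flip of [x], independent by [nD]. *)
have [cQ'|cQ'] := boolP ((l, ~~ c) \in Q).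
  exists (l, ~~ c); first exact: lQP.
  suff -> : (l, ~~ c) |: P = transversal_of (flip x [set l]).
    by rewrite transversal_indep nD.
  apply/setP => -[k e]; rewrite mem_transversal ffunE !inE xpair_eqE.
  have [->|nk] := eqVneq k l.
    by rewrite (negPf (notin _ _ _ nlP)) orbF exl; case: e; case: (x l).
  have /setP/(_ (k, e)) := ex; rewrite mem_transversal !inE xpair_eqE (negPf nk).
  by rewrite /= addbF.
(* Otherwise [Q] has an element off [x], being at least as large as [transversal_of x] and different
   from it. It lies on a leg [k] other than [l]; adding it fills [k] while [l] stays missed. *)
have /subsetPn[[k e] eQ nex] : ~~ (Q \subset transversal_of x).
  apply/negP => sQ.
  have : Q == transversal_of x.
    rewrite eqEcard sQ card_transversal /=.
    by apply: leq_trans ltPQ; rewrite -eP; apply/(leq_trans ge)/card_legsU1.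
  by move=> /eqP eQ; move: iQ; rewrite eQ transversal_indep xD.
move: (nex); rewrite -ex !inE negb_or => /andP[_ kP].
have nkl : k != l.
  apply: contraNneq cQ' => ek; move: eQ nex; rewrite ek mem_transversal -exl.
  by case: (e) (c) => [] [].
exists (k, e); first by rewrite inE kP.
apply/spike_indepP; left; exists k, l; split=> // [d|m fm].
  by rewrite !inE xpair_eqE eq_sym (negPf nkl) notin.
by apply/eqP; apply: contraT => /(full_legU1 fm); rewrite (negPf (nP m)).
Qed.

Lemma spike_matroid_axioms D : 1 < n -> nonadjacent D ->
  matroid_axioms [set: 'I_n * bool] (spike_indep D).
Proof.
move=> n1 nD; apply/and4P; split.
- by apply/forall_inP => P _; apply: subsetT.
- apply: no_full_leg_indep => // [|l]; last by rewrite /full_leg inE.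
  by rewrite imset0 cards0; lia.
- apply/forall_inP => Q iQ; apply/forallP => P; apply/implyP => sPQ.
  exact: spike_indep_sub sPQ iQ.
- apply/forall_inP => P iP; apply/forall_inP => Q iQ; apply/implyP => lt.
  by have [e eQ eP] := spike_indep_aug n1 nD iP iQ lt; apply/exists_inP; exists e.
Qed.

End Spike.

(** * Ranks and circuits *)

Section MatroidRank.
Variables (T : finType) (M : matroid T).
Implicit Types X Y Z I J : {set T}.

Lemma indep_ground I : I \in indep M -> I \subset ground M.
Proof. by have /and4P[/forall_inP h _ _ _] := matroidP M; apply: h. Qed.

Lemma indep0 : set0 \in indep M.
Proof. by have /and4P[] := matroidP M. Qed.

Lemma indep_sub I J : I \subset J -> J \in indep M -> I \in indep M.
Proof.
have /and4P[_ _ /forall_inP h _] := matroidP M => sIJ /h /forallP/(_ I).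
by rewrite sIJ.
Qed.

Lemma indep_aug I J : I \in indep M -> J \in indep M -> #|I| < #|J| ->
  exists2 x, x \in J :\: I & x |: I \in indep M.
Proof.
have /and4P[_ _ _ /forall_inP h] := matroidP M => /h /forall_inP k /k.
by move=> /implyP{}h /h /exists_inP.
Qed.

Lemma card_le_rank I X : I \in indep M -> I \subset X -> #|I| <= rank M X.
Proof. by move=> iI sI; apply: leq_bigmax_cond; rewrite iI. Qed.

Lemma rank_basis X : exists I, [/\ I \in indep M, I \subset X & #|I| = rank M X].
Proof.
have [|I /andP[iI sI] e] := @eq_bigmax_cond _ [pred I | (I \in indep M) && (I \subset X)]
    (fun I : {set T} => #|I|).
  by apply/card_gt0P; exists set0; rewrite inE /= indep0 sub0set.
by exists I.
Qed.

Lemma rank_leP X k :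
  (forall I, I \in indep M -> I \subset X -> #|I| <= k) -> rank M X <= k.
Proof. by move=> h; apply/bigmax_leqP => I /andP[]; apply: h. Qed.

Lemma extend_basis I X : I \in indep M -> I \subset X ->
  exists J, [/\ J \in indep M, I \subset J, J \subset X & #|J| = rank M X].
Proof.
move=> iI sI; have [m] := ubnP (rank M X - #|I|); elim: m I iI sI => // m IH I iI sI ltm.
have [eI|neI] := eqVneq #|I| (rank M X); first by exists I.
have lt : #|I| < rank M X by rewrite ltn_neqAle neI card_le_rank.
have [B [iB sB eB]] := rank_basis X.
have [x] := indep_aug iI iB (leq_trans lt (eq_leq (esym eB))).
rewrite inE => /andP[xI xB] ixI.
have [||J [iJ sJ sJX eJ]] := IH _ ixI.
- by rewrite subUset sub1set (subsetP sB).
- by rewrite cardsU1 xI; move: ltm lt; rewrite ltnS; lia.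
by exists J; split=> //; apply: subset_trans sJ; apply: subsetUr.
Qed.

(** A basis [K] of [Y] containing [C :\ x] cannot grow inside [x |: Y]: with another element of [Y]
    it would exceed the rank of [Y], and with [x] it would contain [C]. *)
Lemma circuit_span C x Y : circuit M C -> x \in C -> C :\ x \subset Y ->
  rank M (x |: Y) = rank M Y.
Proof.
move=> /minsetP[/andP[sCE nC] minC] xC sCY.
have iC : C :\ x \in indep M.
  apply: contraT => nCx; have := minC (C :\ x).
  rewrite nCx (subset_trans (subD1set _ _) sCE) subD1set => /(_ isT isT) e.
  by move: xC; rewrite -e !inE eqxx.
apply/eqP; rewrite eqn_leq; apply/andP; split; last first.
  have [B [iB sB <-]] := rank_basis Y; apply: card_le_rank => //.
  by apply: subset_trans sB _; apply: subsetUr.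
have [K [iK sCK sKY eK]] := extend_basis iC sCY.
rewrite leqNgt; apply/negP => lt.
have [B [iB sB eB]] := rank_basis (x |: Y).
have [|y] := indep_aug iK iB; first by rewrite eK eB.
rewrite inE => /andP[yK /(subsetP sB)]; rewrite in_setU1 => /orP[/eqP->|yY] iyK.
  have sC : C \subset x |: K by rewrite -(setD1K xC) setUS.
  by rewrite (indep_sub sC iyK) in nC.
have := card_le_rank iyK (X := Y); rewrite subUset sub1set yY sKY => /(_ isT).
by rewrite cardsU1 yK eK ltnn.
Qed.

Lemma span_rank Y Z : Y \subset Z ->
  (forall z, z \in Z -> rank M (z |: Y) = rank M Y) -> rank M Z = rank M Y.
Proof.
move=> sYZ h; apply/eqP; rewrite eqn_leq; apply/andP; split; last first.
  have [B [iB sB <-]] := rank_basis Y; apply: card_le_rank => //.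
  exact: subset_trans sB sYZ.
rewrite leqNgt; apply/negP => lt.
have [K [iK sK eK]] := rank_basis Y; have [B [iB sB eB]] := rank_basis Z.
have [|z] := indep_aug iK iB; first by rewrite eK eB.
rewrite inE => /andP[zK /(subsetP sB) zZ] izK.
by have := card_le_rank izK (setUS [set z] sK); rewrite h // cardsU1 zK eK ltnn.
Qed.

Lemma indep_rank I : (I \in indep M) = (rank M I == #|I|).
Proof.
apply/idP/eqP => [iI|e].
  apply/eqP; rewrite eqn_leq card_le_rank // andbT.
  by apply: rank_leP => J _; apply: subset_leq_card.
have [J [iJ sJ eJ]] := rank_basis I.
by suff <- : J = I by []; apply/eqP; rewrite eqEcard sJ eJ e leqnn.
Qed.

End MatroidRank.

(** * Images of matroids under injections *)

Section Push.
Variables (T U : finType) (f : U -> T).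
Hypothesis f_inj : injective f.

(** This carries the matroids on ['I_n * bool] to the ground set of a given spike. *)
Lemma image_matroid_axioms (E : {set U}) (Is : {set {set U}}) :
  matroid_axioms E Is ->
  matroid_axioms (f @: E) [set f @: (I : {set U}) | I in Is].
Proof.
move=> /and4P[/forall_inP sE I0 /forall_inP her /forall_inP aug].
apply/and4P; split.
- by apply/forall_inP => _ /imsetP[I iI ->]; apply/imsetS/sE.
- by apply/imsetP; exists set0; rewrite ?imset0.
- apply/forall_inP => _ /imsetP[J iJ ->]; apply/forallP => I; apply/implyP => sI.
  apply/imsetP; exists (f @^-1: I).
    have /forallP/(_ (f @^-1: I))/implyP := her J iJ; apply.
    by apply/subsetP => u; rewrite inE => /(subsetP sI); rewrite mem_imset.
  apply/setP => y; apply/idP/imsetP => [yI|[u]]; last by rewrite inE => ? ->.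
  by have /imsetP[u _ eu] := subsetP sI _ yI; exists u; rewrite // inE -eu.
- apply/forall_inP => _ /imsetP[I iI ->]; apply/forall_inP => _ /imsetP[J iJ ->].
  rewrite !card_imset //; apply/implyP => lt.
  have /forall_inP/(_ J iJ)/implyP/(_ lt)/exists_inP[x xJ xI] := aug I iI.
  apply/exists_inP; exists (f x); last by rewrite -imsetU1 imset_f.
  by move: xJ; rewrite !inE !mem_imset.
Qed.

End Push.

(** * Normal form of a spike *)

(** The triangles and the ranks of unions of legs decide the independence of every set except the
    transversals, and [D] records these. *)
Lemma spike_structure (T : finType) (n : nat) (M : matroid T) : spike n M ->
  exists (f : 'I_n * bool -> T) (D : {set {ffun 'I_n -> bool}}),
    [/\ injective f, nonadjacent D, ground M = f @: setT
      & forall P : {set 'I_n * bool}, (f @: P \in indep M) = (P \in spike_indep D)].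
Proof.
move=> [n2 [N [t [a [b [un gN rN [tri legs] ->]]]]]].
pose f (e : 'I_n * bool) := if e.2 then b e.1 else a e.1.
have fE i c : f (i, c) = if c then b i else a i by [].
have [tnf f_inj] : (forall e, t != f e) /\ injective f.
  move: un; rewrite /= mem_cat negb_or cat_uniq => /andP[/andP[ta tb]].
  case/and3P => ua /hasPn ab ub.
  split=> [[i []]|[i []] [j []]] //=; rewrite ?fE.
  - by apply: contra tb => /eqP ->; apply: codom_f.
  - by apply: contra ta => /eqP ->; apply: codom_f.
  - by move=> /(injectiveP _ ub) ->.
  - by move=> e; have := ab _ (codom_f b i); rewrite /f /= in e *; rewrite e codom_f.
  - by move=> e; have := ab _ (codom_f b j); rewrite /f /= in e *; rewrite -e codom_f.
  - by move=> /(injectiveP _ ua) ->.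
have gE : ground N = t |: f @: setT.
  rewrite gN; apply/setP => x; rewrite !inE mem_cat; congr (_ || _).
  apply/orP/imsetP => [[/codomP[i ->]|/codomP[i ->]]|[[i []] _ ->]].
  - by exists (i, false).
  - by exists (i, true).
  - by right; apply: codom_f.
  - by left; apply: codom_f.
have tnP (P : {set 'I_n * bool}) : t \notin f @: P.
  by apply/negP => /imsetP[e _ et]; have := tnf e; rewrite -et eqxx.
have fs (P : {set 'I_n * bool}) : f @: P \subset ground N.
  by rewrite gE; apply/(subset_trans _ (subsetUr _ _))/imsetS/subsetT.
have cardf (P : {set 'I_n * bool}) : #|f @: P| = #|P| by apply: card_imset.
pose legsof (J : {set 'I_n}) : {set 'I_n * bool} := setX J setT.
have flegs (J : {set 'I_n}) : \bigcup_(j in J) [set a j; b j] = f @: legsof J.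
  apply/setP => x; apply/bigcupP/imsetP.
    case=> j jJ; rewrite !inE => /orP[]/eqP ->.
      by exists (j, false) => //; rewrite !inE jJ.
    by exists (j, true) => //; rewrite !inE jJ.
  case=> -[j c]; rewrite !inE andbT /= => jJ ->; exists j => //.
  by rewrite /f !inE /=; case: (c); rewrite eqxx ?orbT.
(* Two legs have four elements but rank 3. *)
have two (P : {set 'I_n * bool}) i j : i != j -> full_leg P i -> full_leg P j ->
    f @: P \notin indep N.
  move=> ij fi fj; apply/negP => iP.
  have r : rank N (\bigcup_(k in [set i; j]) [set a k; b k]) = 3.
    rewrite legs ?cards2 ?ij //; first by apply/set0Pn; exists i; rewrite !inE eqxx.
    by rewrite properEcard subsetT cards2 ij cardsT card_ord.
  have sP : f @: legsof [set i; j] \subset f @: P.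
    apply/imsetS/subsetP => -[k c]; rewrite !inE /= andbT => /orP[]/eqP ->.
      exact/full_legP.
    exact/full_legP.
  have := card_le_rank (indep_sub sP iP) (subxx _).
  by rewrite -flegs r flegs cardf cardsX cards2 ij cardsT card_bool.
have triE i : [set t; a i; b i] = t |: [set f (i, false); f (i, true)].
  by apply/setP => z; rewrite !inE orbA.
have rank_t (P : {set 'I_n * bool}) i : full_leg P i ->
    rank N (t |: f @: P) = rank N (f @: P).
  move=> /full_legP fi; have /andP[ci _] := tri i.
  apply: (circuit_span ci); first by rewrite triE setU11.
  rewrite triE setU1K; first by rewrite subUset !sub1set !imset_f ?fi.
  by rewrite !inE negb_or !tnf.
(* With [t] and one element of a leg, the triangle spans the other element. *)
have rank_legs (P : {set 'I_n * bool}) :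
    rank N (t |: f @: legsof (fst @: P)) = rank N (t |: f @: P).
  apply: span_rank.
    apply/setUS/imsetS/subsetP => -[l c] lP; rewrite !inE andbT.
    by apply/imsetP; exists (l, c).
  move=> z; rewrite in_setU1 => /orP[/eqP ->|]; first by rewrite setUA setUid.
  case/imsetP => -[l c]; rewrite !inE andbT /= => /imsetP[[l' c'] lP /= -> ->] {l}.
  have [->|nc] := eqVneq c c'.
    by rewrite setUCA [f _ |: _](setUidPr _) // sub1set imset_f.
  have /andP[cl _] := tri l'; apply: (circuit_span cl).
    by rewrite triE !inE; case: (c); rewrite eqxx ?orbT.
  rewrite subDset triE; apply/subsetP => y; rewrite !inE.
  have ec : c' = ~~ c by case: c c' nc {lP} => [] [].
  have fP : f (l', ~~ c) \in f @: P by rewrite -ec imset_f.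
  case/or3P => /eqP ->; first by rewrite eqxx orbT.
    by case: c {nc ec} fP => fP; rewrite ?fP ?eqxx ?orbT.
  by case: c {nc ec} fP => fP; rewrite ?fP ?eqxx ?orbT.
(* The full leg spans [t], and then [P] spans every leg it meets. So its rank is at least
   [#|J| + 1], which bounds its size from above. *)
have one (P : {set 'I_n * bool}) i : #|fst @: P| < n -> full_leg P i ->
    (forall l, full_leg P l -> l = i) -> f @: P \in indep N.
  move=> ltn fi hi; set J := fst @: P in ltn *.
  have r : rank N (\bigcup_(k in J) [set a k; b k]) = #|J| + 1.
    apply: legs.
      apply/set0Pn; exists i; apply/imsetP; exists (i, true) => //.
      exact: (full_legP _ _ fi).
    by rewrite properEcard subsetT cardsT card_ord.
  rewrite indep_rank eqn_leq; apply/andP; split.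
    by apply: rank_leP => I _; apply: subset_leq_card.
  rewrite cardf (leq_trans (card_one_full_leg hi)) // -(rank_t _ _ fi) -rank_legs.
  rewrite -addn1 -r flegs; have [I [iI sI <-]] := rank_basis N (f @: legsof J).
  by apply: card_le_rank => //; apply: subset_trans sI (subsetUr _ _).
(* Completing one leg that [P] meets reduces this to [one]. *)
have none (P : {set 'I_n * bool}) : #|fst @: P| < n ->
    (forall l, ~~ full_leg P l) -> f @: P \in indep N.
  move=> ltn h; have [->|/set0Pn[[i c] iP]] := eqVneq P set0.
    by rewrite imset0 indep0.
  apply: (@indep_sub _ _ _ (f @: ((i, ~~ c) |: P))); first exact/imsetS/subsetUr.
  apply: (one _ i).
  - rewrite imsetU1 /= (setUidPr _) // sub1set; by apply/imsetP; exists (i, c).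
  - apply/full_legP => e; rewrite !inE xpair_eqE eqxx.
    by case: c e iP => [] [] iP; rewrite ?iP ?orbT.
  - move=> l fl; apply/eqP; apply: contraT => /(full_legU1 fl).
    by rewrite (negPf (h l)).
pose D := [set x | f @: transversal_of x \notin indep N].
(* [Z] is [x] without leg [i]; [Q] drops leg [j] from [x] instead and fills leg [i]. Both are
   independent, and [Q] can augment [Z] only on leg [i], so [x] or its flip at [i] is
   independent. *)
have nD : nonadjacent D.
  move=> x i; rewrite !inE => dx; apply/negP => dx'.
  have [j ji] : exists j : 'I_n, j != i.
    have n0 : 0 < n by apply: ltn_trans n2.
    have n1 : 1 < n by apply: ltn_trans n2.
    exists (if i == Ordinal n0 then Ordinal n1 else Ordinal n0).
    by case: (eqVneq i (Ordinal n0)) => [->|]; rewrite // eq_sym.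
  pose Z := transversal_of x :\ (i, x i).
  pose Q := (transversal_of x :\ (j, x j)) :|: [set (i, ~~ x i)].
  have Zi c : (i, c) \notin Z.
    by rewrite !inE /= xpair_eqE eqxx; case: c; case: (x i).
  have iZ : f @: Z \in indep N.
    apply: none; first exact: (missing_leg Zi).
    move=> l; apply: contra (transversal_full x l) => /full_legP h.
    by apply/full_legP => c; have := h c; rewrite inE => /andP[].
  have iQ : f @: Q \in indep N.
    apply: (one _ i).
    - apply: (@missing_leg _ _ j) => c.
      rewrite !inE /= !xpair_eqE (negPf ji) eqxx /= orbF.
      by case: c; case: (x j).
    - apply/full_legP => c; rewrite !inE /= !xpair_eqE eqxx eq_sym (negPf ji) /=.
      by case: c; case: (x i).
    - move=> l /full_legP h; apply/eqP; apply: contraT => nl.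
      have := h (~~ x l); rewrite !inE /= !xpair_eqE (negPf nl) orbF.
      by case: (x l); rewrite andbF.
  have lt : #|f @: Z| < #|f @: Q|.
    rewrite !cardf; have := cardsD1 (i, x i) (transversal_of x).
    have := cardsD1 (j, x j) (transversal_of x).
    rewrite !mem_transversal !eqxx /= => -> /eqP; rewrite eqSS => /eqP eZ.
    rewrite /Z -eZ; apply: proper_card; rewrite properE subsetUl /=.
    apply/negP => /subsetP/(_ (i, ~~ x i)); rewrite !inE eqxx orbT => /(_ isT) /=.
    by case: (x i); rewrite andbF.
  have [y] := indep_aug iZ iQ lt.
  rewrite inE => /andP[yZ /imsetP[[k c] kQ ey]]; rewrite {}ey in yZ *.
  rewrite -imsetU1 => iU; have ek : k = i.
    apply/eqP; apply: contraNT yZ => nk; apply: imset_f.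
    by move: kQ; rewrite !inE /= !xpair_eqE (negPf nk) /= orbF => /andP[].
  have [ec|nc] := eqVneq c (x i).
    move: dx; rewrite -(setD1K (_ : (i, x i) \in transversal_of x)).
      by rewrite -/Z -{1}ec -{1}ek iU.
    by rewrite mem_transversal.
  have eU : (k, c) |: Z = transversal_of (flip x [set i]).
    apply/setP => -[l e]; rewrite mem_transversal ffunE !inE /= !xpair_eqE ek.
    have [->|nl] /= := eqVneq l i; last by rewrite addbF.
    by case: c e (x i) nc {yZ kQ iU} => [] [] [].
  by rewrite -eU iU in dx'.
exists f, D; split=> //.
  by rewrite /= gE setU1K // tnP.
move=> P; rewrite /= inE tnP andbT; apply/idP/spike_indepP => [iP|].
  have [/existsP[k fk]|] := boolP [exists k, full_leg P k].
    have uk l : full_leg P l -> l = k.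
      by move=> fl; apply/eqP; apply: contraT => /two/(_ fl)/(_ fk); rewrite iP.
    apply/spike_indepP/(one_full_leg_indep _ _ fk uk).
    apply: leq_trans (card_full_leg fk) _; rewrite -cardf.
    by apply: leq_trans (card_le_rank iP (fs P)) _; rewrite rN.
  rewrite negb_exists => /forallP h; apply/spike_indepP.
  have [lt|ge] := ltnP #|fst @: P| n; first by apply: no_full_leg_indep => //; apply: ltnW.
  have [x ex] := full_transversal h ge.
  by rewrite ex transversal_indep inE -ex iP.
case=> [[i [j [_ hj hi]]]|[x + ->]]; last by rewrite inE negbK.
have lt := missing_leg hj.
have [/existsP[k fk]|] := boolP [exists k, full_leg P k].
  by apply: (one _ k) => // l; rewrite (hi _ fk); apply: hi.
by rewrite negb_exists => /forallP h; apply: none.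
Qed.

(** * Subset sums in a finite abelian group *)

Section SubsetSums.
Variables (V : finZmodType) (I : finType).
Implicit Types (d : I -> V) (A B : {set I}).
Local Open Scope ring_scope.

(** Translation by [v] permutes [V], so it leaves the sum of all elements unchanged. *)
Lemma mulrn_card_eq0 (v : V) : v *+ #|V| = 0.
Proof.
have := reindex_inj (op := +%R) (x := 0) (P := xpredT) (F := id) (@addrI V v).
rewrite /= big_split /= sumr_const => e.
by apply: (addIr (\sum_(w : V) w)); rewrite add0r -e.
Qed.

Definition subset_sums d A : {set V} := [set \sum_(i in (B : {set I})) d i | B in powerset A].

Definition sum_fiber d A (s : V) : {set {set I}} :=
  [set B : {set I} in powerset A | \sum_(i in B) d i == s].

(** Sort the subsets by whether they contain [a]; removing [a] lowers the sum by [d a]. *)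
Lemma card_sum_fiberU1 d A a s : a \notin A ->
  #|sum_fiber d (a |: A) s| = (#|sum_fiber d A s| + #|sum_fiber d A (s - d a)%R|)%N.
Proof.
move=> aA; rewrite -(cardsID [set B : {set I} | a \notin B] (sum_fiber d (a |: A) s)).
congr (_ + _)%N.
  apply: eq_card => B; rewrite !inE andbC.
  have [aB|aB] /= := boolP (a \in B).
    by apply/esym/negbTE; apply: contra aA => /andP[/subsetP sB _]; apply: sB.
  suff -> : (B \subset a |: A) = (B \subset A) by [].
  by rewrite -{2}(setU1K aA) subsetD1 aB andbT.
rewrite -(@card_in_imset _ _ (fun B : {set I} => a |: B) (sum_fiber d A (s - d a))); last first.
  move=> B C; rewrite !inE => /andP[sB _] /andP[sC _] e.
  have na (D : {set I}) : D \subset A -> a \notin D by move=> sD; apply: contra aA; apply: (subsetP sD).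
  by rewrite -(setU1K (na _ sB)) e setU1K ?na.
apply: eq_card => B; rewrite !inE negbK; apply/andP/imsetP.
  case=> aB /andP[sB /eqP <-]; exists (B :\ a); last by rewrite setD1K.
  by rewrite !inE subDset sB [\sum_(i in B) _](big_setD1 a) //= addrAC subrr add0r eqxx.
case=> C; rewrite !inE => /andP[sC /eqP e] ->; split; first by rewrite !inE eqxx.
have aC : a \notin C by apply: contra aA; apply: (subsetP sC).
by rewrite setUS //= big_setU1 //= e addrC subrK.
Qed.

(* Each new element either enlarges the set of subset sums or, if the set of
   sums is invariant under translation by it, doubles every nonempty fiber. *)
Lemma card_sum_fiber_ge d A s : s \in subset_sums d A ->
  (2 ^ #|A| < #|sum_fiber d A s| * 2 ^ #|subset_sums d A|)%N.
Proof.
have sub0 : subset_sums d set0 = [set 0].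
  apply/setP => v; rewrite !inE; apply/imsetP/eqP => [[B]|->].
    by rewrite inE subset0 => /eqP -> ->; rewrite big_set0.
  by exists set0; rewrite ?inE ?sub0set // big_set0.
have fib0 B t : (t \in subset_sums d B) = (0 < #|sum_fiber d B t|)%N.
  apply/imsetP/card_gt0P => [[C sC ->]|[C]]; first by exists C; rewrite inE sC eqxx.
  by rewrite inE => /andP[sC /eqP <-]; exists C.
have [m] := ubnP #|A|; elim: m A s => // m IH A s.
have [->|/set0Pn[a aA]] := eqVneq A set0.
  by rewrite fib0 sub0 cards0 cards1 => _ h; lia.
rewrite (cardsD1 a) aA add1n ltnS => ltm sA.
have aB : a \notin A :\ a by rewrite !inE eqxx.
rewrite -(setD1K aA) in sA *; set B := A :\ a in ltm sA aB *; rewrite setU1K //.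
have IHB t := IH B t ltm.
have mono : subset_sums d B \subset subset_sums d (a |: B).
  by apply/imsetS; rewrite powersetS subsetUr.
have shift t : t \in subset_sums d B -> t + d a \in subset_sums d (a |: B).
  by rewrite !fib0 card_sum_fiberU1 // addrK; lia.
have := sA; rewrite fib0 !card_sum_fiberU1 // addn_gt0 -!fib0.
have [le|gt] := leqP #|subset_sums d (a |: B)| #|subset_sums d B|; last first.
  have h : (2 ^ #|subset_sums d B| * 2 <= 2 ^ #|subset_sums d (a |: B)|)%N.
    by rewrite -expnSr leq_exp2l.
  have h2 z : (2 ^ #|B| < z * 2 ^ #|subset_sums d B| ->
      2 ^ #|B|.+1 < z * 2 ^ #|subset_sums d (a |: B)|)%N.
    move=> lt; apply: (@leq_trans (z * (2 ^ #|subset_sums d B| * 2))).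
      by rewrite mulnA expnSr ltn_pmul2r.
    by rewrite leq_mul2l h orbT.
  case/orP => /IHB/h2 lt; apply: leq_trans lt _; rewrite leq_mul2r.
    by rewrite leq_addr orbT.
  by rewrite leq_addl orbT.
have eS : subset_sums d B = subset_sums d (a |: B).
  by apply/eqP; rewrite eqEcard mono.
(* Adding [d a] maps the finite set of sums injectively into itself, hence onto. So [s - d a] is a
   sum too, and the induction bound holds for both fibers. *)
have eT : (fun v => v + d a) @: subset_sums d B = subset_sums d B.
  apply/eqP; rewrite eqEcard (card_imset _ (addIr _)) leqnn andbT.
  by apply/subsetP => _ /imsetP[v vB ->]; rewrite eS; apply: shift.
move=> _; have sB : s \in subset_sums d B by rewrite eS.
have sB' : s - d a \in subset_sums d B.
  by move: sB; rewrite -{1}eT => /imsetP[v vB ->]; rewrite addrK.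
rewrite expnS -eS; have := IHB _ sB; have := IHB _ sB'; lia.
Qed.

Lemma card_sum_solutions d s (x0 : {ffun I -> bool}) :
  \sum_(i | x0 i) d i = s ->
  (2 ^ #|I| <= #|[set x : {ffun I -> bool} | (\sum_(i | x i) d i)%R == s]| * 2 ^ #|V|)%N.
Proof.
move=> e0; have sI : s \in subset_sums d [set: I].
  apply/imsetP; exists [set i | x0 i]; first by rewrite inE subsetT.
  by rewrite -e0; apply: eq_bigl => i; rewrite inE.
have := card_sum_fiber_ge sI; rewrite cardsT => /ltnW/leq_trans; apply.
apply: leq_mul; last by rewrite leq_exp2l ?max_card.
pose f (B : {set I}) : {ffun I -> bool} := [ffun i => i \in B].
have f_inj : injective f.
  by move=> B C /ffunP e; apply/setP => i; have := e i; rewrite !ffunE.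
rewrite -(card_imset _ f_inj); apply: subset_leq_card; apply/subsetP => y /imsetP[B].
rewrite !inE => /andP[_ /eqP <-] ->; apply/eqP.
by apply: eq_bigl => i; rewrite ffunE.
Qed.

Lemma sum_flip d x A : \sum_(i | flip x A i) d i =
  \sum_(i | x i) d i + \sum_(i in A) (if x i then - d i else d i).
Proof.
rewrite big_mkcond [X in X + _]big_mkcond [X in _ + X]big_mkcond -big_split /=.
apply: eq_bigr => i _; rewrite ffunE.
by case: (x i); case: (i \in A); rewrite /= ?subrr ?addr0 ?add0r.
Qed.

(** There are [#|V| ^ 2] possible pairs [(d i, d' i)], so one of them occurs at least [#|V|] times;
    exactly [#|V|] such indices form [A]. *)
Lemma common_zero_sum (d d' : I -> V) : (#|V| ^ 3 < #|I|)%N ->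
  exists A : {set I}, [/\ A != set0, \sum_(i in A) d i = 0 & \sum_(i in A) d' i = 0].
Proof.
move=> ltq; have q0 : (0 < #|V|)%N by apply/card_gt0P; exists 0.
have [/existsP[c hc]|] :=
    boolP [exists c : V * V, #|V| <= #|[set i | (d i, d' i) == c]|]%N; last first.
  rewrite negb_exists => /forallP h; move: ltq.
  suff -> : (#|V| ^ 3 < #|I|)%N = false by [].
  apply/negbTE; rewrite -leqNgt -sum1_card.
  rewrite (partition_big (fun i => (d i, d' i)) xpredT) //=.
  apply: (@leq_trans (\sum_(c : V * V) #|V|)); last first.
    by rewrite sum_nat_const card_prod !expnS expn0 muln1 mulnA.
  by apply: leq_sum => c _; rewrite sum1dep_card; have := h c; rewrite -ltnNge => /ltnW.
have [s [us ss sc]] := card_geqP hc.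
have cA : #|[set:: s]| = #|V| by rewrite -ss -(card_uniqP us); apply: eq_card => i; rewrite inE.
have dc i : i \in [set:: s] -> (d i, d' i) = c.
  by rewrite inE => /sc; rewrite inE => /eqP.
exists [set:: s]; split; first by rewrite -card_gt0 cA.
  rewrite (eq_bigr (fun _ => c.1)) => [|i /dc <- //].
  by rewrite sumr_const cA mulrn_card_eq0.
rewrite (eq_bigr (fun _ => c.2)) => [|i /dc <- //].
by rewrite sumr_const cA mulrn_card_eq0.
Qed.

(** The zero sums are taken over the changes caused by flipping, whose signs depend on [x]. *)
Lemma equal_sums_flip (d d' : I -> V) (x : {ffun I -> bool}) : (#|V| ^ 3 < #|I|)%N ->
  exists y, [/\ y != x, \sum_(i | y i) d i = \sum_(i | x i) d i
              & \sum_(i | y i) d' i = \sum_(i | x i) d' i].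
Proof.
move=> ltq.
have [A [/set0Pn[i iA] e e']] := common_zero_sum
  (fun i => if x i then - d i else d i) (fun i => if x i then - d' i else d' i) ltq.
exists (flip x A); rewrite !sum_flip e e' !addr0; split=> //.
by apply/eqP => /ffunP/(_ i); rewrite ffunE iA; case: (x i).
Qed.
End SubsetSums.

(** * Representations of spikes *)

Section LinearCoefficients.
Local Open Scope ring_scope.

(** Coefficients on all of [T] that vanish off [P] let relations with different supports be
    combined. *)
Lemma free_coefP (F : finFieldType) (V : vectType F) (T : finType) (v : T -> V)
    (P : {set T}) :
  reflect (forall k : {ffun T -> F}, (forall e, e \notin P -> k e = 0) ->
             \sum_e k e *: v e = 0 -> forall e, k e = 0)
          (free [seq v e | e in P]).
Proof.
have nX (i : 'I_#|P|) : [tuple of [seq v e | e in P]]`_i = v (enum_val i).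
  exact: nth_image.
apply: (iffP (@freeP _ _ _ [tuple of [seq v e | e in P]])) => [h k k0 ks e|h k ks j].
  have [eP|/k0 //] := boolP (e \in P).
  rewrite -(enum_rankK_in eP eP).
  apply: (h (fun i => k (enum_val i))); rewrite -[RHS]ks.
  transitivity (\sum_(u in P) k u *: v u).
    by rewrite [RHS]big_enum_val; apply: eq_bigr => i _; rewrite nX.
  by apply: big_rmcond => u /k0 ->; rewrite scale0r.
(* From ranks to elements: the sum has one term for [e] in [P] and none otherwise. *)
pose k' := [ffun e => \sum_(i | enum_val i == e) k i].
have kj i : k' (enum_val i) = k i.
  by rewrite ffunE (big_pred1 i) // => l; rewrite (inj_eq enum_val_inj).
rewrite -kj; apply: h => [e eP|].
  rewrite ffunE big_pred0 // => i; apply: contraNF eP => /eqP <-; exact: enum_valP.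
rewrite -[RHS]ks (partition_big (@enum_val _ (mem P)) xpredT) //=.
apply: eq_bigr => e _; rewrite ffunE scaler_suml.
by apply: eq_bigr => i /eqP <-; rewrite nX.
Qed.

(** [F] and [T] are finite, so a search through all coefficient functions yields the witness
    constructively. *)
Lemma dependent_coef (F : finFieldType) (V : vectType F) (T : finType) (v : T -> V)
    (P : {set T}) : ~~ free [seq v e | e in P] ->
  exists k : {ffun T -> F}, [/\ forall e, e \notin P -> k e = 0,
    \sum_e k e *: v e = 0 & exists e, k e != 0].
Proof.
pose b (k : {ffun T -> F}) := [forall e, (e \notin P) ==> (k e == 0)]
  && (\sum_e k e *: v e == 0) && [exists e, k e != 0].
have [/existsP[k /andP[/andP[/forallP k0 /eqP ks] /existsP[e ke]]] _|] :=
    boolP [exists k, b k].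
  by exists k; split=> // [u uP|]; [apply/eqP; have /implyP := k0 u; apply | exists e].
rewrite negb_exists => /forallP nb; case/free_coefP => k k0 ks e.
apply/eqP; apply: contraT => ke; have := nb k; rewrite /b ks eqxx andbT.
suff -> : [forall e, (e \notin P) ==> (k e == 0)] by case/existsP; exists e.
by apply/forallP => u; apply/implyP => /k0 ->.
Qed.

End LinearCoefficients.

Section Representation.
Local Open Scope ring_scope.
Variables (F : finFieldType) (n m : nat) (w : 'I_n * bool -> 'cV[F]_m).
Variable D : {set {ffun 'I_n -> bool}}.
Hypothesis n3 : (3 < n)%N.
Hypothesis wD : forall P, (P \in spike_indep D) = free [seq w e | e in P].

Let relation (k : 'I_n * bool -> F) :=
  \sum_i (k (i, false) *: w (i, false) + k (i, true) *: w (i, true)) = 0.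

Lemma relation_sum k : \sum_e k e *: w e =
  \sum_i (k (i, false) *: w (i, false) + k (i, true) *: w (i, true)).
Proof.
rewrite (eq_bigr (fun e => k (e.1, e.2) *: w (e.1, e.2))) => [|[] //].
rewrite -(pair_bigA _ (fun i c => k (i, c) *: w (i, c))) /=.
by apply: eq_bigr => i _; rewrite big_bool addrC.
Qed.

Lemma relationB a k l : relation k -> relation l -> relation (fun e => k e - a * l e).
Proof.
rewrite /relation => ek el.
transitivity (\sum_i (k (i, false) *: w (i, false) + k (i, true) *: w (i, true))
  - a *: \sum_i (l (i, false) *: w (i, false) + l (i, true) *: w (i, true))).
  rewrite scaler_sumr -sumrB; apply: eq_bigr => i _.
  by rewrite scalerDr !scalerBl !scalerA opprD addrACA.
by rewrite ek el scaler0 subrr.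
Qed.

Lemma relationZ a k : relation k -> relation (fun e => a * k e).
Proof.
rewrite /relation => ek.
transitivity (a *: \sum_i (k (i, false) *: w (i, false) + k (i, true) *: w (i, true))).
  by rewrite scaler_sumr; apply: eq_bigr => i _; rewrite scalerDr !scalerA.
by rewrite ek scaler0.
Qed.

Lemma relation_indep P k : P \in spike_indep D -> relation k ->
  (forall e, e \notin P -> k e = 0) -> forall e, k e = 0.
Proof.
rewrite wD => /free_coefP h kr k0 e; have := h [ffun e => k e]; move=> /(_ _ _ e).
rewrite ffunE; apply=> [u uP|]; first by rewrite ffunE k0.
by rewrite -[RHS]kr -relation_sum; apply: eq_bigr => u _; rewrite ffunE.
Qed.

Lemma relation_dep P : P \notin spike_indep D ->
  exists k, [/\ relation k, forall e, e \notin P -> k e = 0 & exists e, k e != 0].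
Proof.
rewrite wD => /dependent_coef[k [k0 ks ke]]; exists k; split=> //.
by rewrite /relation -relation_sum.
Qed.

Lemma leg_avoiding3 (i j l : 'I_n) : exists o, [/\ o != i, o != j & o != l].
Proof.
have /subsetPn[o _] : ~~ ([set: 'I_n] \subset [set i; j; l]).
  apply/negP => /subset_leq_card; rewrite cardsT card_ord => h.
  have := leq_trans n3 h; rewrite -setUA cardsU1 cards2.
  by case: (_ \notin _); case: (_ != _).
by rewrite !inE !negb_or => /andP[/andP[? ?] ?]; exists o.
Qed.

(** Two full legs are dependent, but dropping any one of the four elements leaves an independent
    set, so all four coefficients are nonzero. *)
Lemma two_leg_relation i j : i != j -> exists k,
  [/\ relation k, forall l c, l != i -> l != j -> k (l, c) = 0,
      forall c, k (i, c) != 0 & forall c, k (j, c) != 0].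
Proof.
move=> ij; pose P : {set 'I_n * bool} := [set e | (e.1 == i) || (e.1 == j)].
have full l : (l == i) || (l == j) -> full_leg P l.
  by move=> hl; apply/full_legP => c; rewrite inE.
have /relation_dep[k [kr k0 [e0 ke0]]] : P \notin spike_indep D.
  have n0 : (0 < n)%N by lia.
  apply/negP => /(spike_indep_one_full n0)[o ho].
  have := ho i (full i _); rewrite eqxx => /(_ isT) ei.
  have := ho j (full j _); rewrite eqxx orbT => /(_ isT) ej.
  by rewrite ei ej eqxx in ij.
have kP e : e \in P -> k e != 0.
  move=> eP; apply: contra ke0 => /eqP ke; apply/eqP.
  apply: (relation_indep (P := P :\ e)) => // [|u]; last first.
    by rewrite !inE negb_and negbK => /orP[/eqP -> //|uP]; apply: k0; rewrite inE.
  have [o [oi oj _]] := leg_avoiding3 i j j.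
  apply/spike_indepP; left; exists (if e.1 == i then j else i), o; split.
  - by case: ifP => _; rewrite eq_sym.
  - by move=> c; rewrite !inE /= (negPf oi) (negPf oj) andbF.
  - case: e eP {ke} => e1 c; rewrite inE /= => eP l /full_legP fl.
    have := fl c; rewrite !inE /= !xpair_eqE eqxx andbT => /andP[ne hl].
    move: hl ne eP; have [->|_] := eqVneq e1 i => /=.
      by case: eqP => //= _ /eqP.
    by move=> hl ne /eqP ej; move: hl; rewrite -ej (negPf ne) orbF => /eqP.
exists k; split=> // [l c li lj|c|c].
- by apply: k0; rewrite inE negb_or li.
- by apply: kP; rewrite inE eqxx.
- by apply: kP; rewrite inE eqxx orbT.
Qed.

(* The tip of the spike is the common point of the lines spanned by the legs. *)
Lemma exists_tip : exists (t : 'cV[F]_m) (al be : 'I_n -> F),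
  forall i, [/\ al i != 0, be i != 0 & t = al i *: w (i, false) + be i *: w (i, true)].
Proof.
have n0 : (0 < n)%N by lia.
pose o := Ordinal n0; have [i1 [i1o _ _]] := leg_avoiding3 o o o.
have normal i : i != o -> exists k,
    [/\ relation k, forall l c, l != i -> l != o -> k (l, c) = 0,
        forall c, k (i, c) != 0, forall c, k (o, c) != 0 & k (o, true) = 1].
  move=> /two_leg_relation[k [kr k0 ki ko]].
  exists (fun e => (k (o, true))^-1 * k e); split=> [|l c li lo|c|c|].
  - exact: relationZ.
  - by rewrite k0 ?mulr0.
  - by rewrite mulf_neq0 ?invr_neq0.
  - by rewrite mulf_neq0 ?invr_neq0.
  - by rewrite mulVf.
have [k1 [k1r k10 k1i k1o k11]] := normal _ i1o.
(* The part on leg [o] of the normalized relation between [o] and [i1]; the part on the other leg is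
   its negative. *)
pose t := w (o, true) + k1 (o, false) *: w (o, false).
exists t; suff /fin_all_exists[ab hab] : forall i, exists ab : F * F,
    [/\ ab.1 != 0, ab.2 != 0 & t = ab.1 *: w (i, false) + ab.2 *: w (i, true)].
  by exists (fun i => (ab i).1), (fun i => (ab i).2).
move=> i; have [->|io] := eqVneq i o.
  by exists (k1 (o, false), 1); rewrite /= oner_neq0 scale1r addrC.
have [k [kr k0 ki ko kt]] := normal _ io.
(* All normalized relations agree on leg [o], so every leg leads to the same [t]. *)
have ek : k (o, false) = k1 (o, false).
  have [eii|ii1] := eqVneq i i1.
    (* Cancelling [(i1, true)] leaves leg [o] and [(i1, false)], an independent set; so [k] is a
       multiple of [k1], and the normalization makes the factor 1. *)
    subst i; pose g e := k e - k (i1, true) / k1 (i1, true) * k1 e.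
    have gr : relation g by apply: relationB.
    have [p [pi po _]] := leg_avoiding3 i1 o o.
    have g0 : forall e, g e = 0.
      apply: (relation_indep (P := [set e | (e.1 == o) || (e == (i1, false))])) => //.
        apply/spike_indepP; left; exists o, p; split; first by rewrite eq_sym.
          by move=> c; rewrite inE /= xpair_eqE (negPf po) (negPf pi).
        move=> l /full_legP/(_ true); rewrite inE /= xpair_eqE andbF orbF.
        by move/eqP.
      move=> [l c]; rewrite inE /= xpair_eqE negb_or => /andP[lo].
      have [->|li] := eqVneq l i1; last by rewrite /g (k0 l) // (k10 l) // mulr0 subrr.
      case: c => //= _; rewrite /g mulfVK ?subrr //.
    have := g0 (o, true); rewrite /g kt k11 mulr1 => /eqP; rewrite subr_eq0 => /eqP e1.
    by have := g0 (o, false); rewrite /g -e1 mul1r => /eqP; rewrite subr_eq0 => /eqP.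
  have [h [hr h0 hi h1]] := two_leg_relation ii1.
  (* The difference cancels [(o, true)], and a multiple of [h] then cancels [(i1, true)]. What
     remains lies on leg [i], [(i1, false)] and [(o, false)], independent because a fourth leg [p]
     is missed. *)
  pose g e := k e - 1 * k1 e.
  pose g' e := g e - g (i1, true) / h (i1, true) * h e.
  have gr : relation g' by do 2 apply: relationB => //.
  have [p [pi p1 po]] := leg_avoiding3 i i1 o.
  have g0 : forall e, g' e = 0.
    apply: (relation_indep
      (P := [set e | [|| e.1 == i, e == (i1, false) | e == (o, false)]])) => //.
      apply/spike_indepP; left; exists i, p; split; first by rewrite eq_sym.
        by move=> c; rewrite inE /= !xpair_eqE (negPf pi) (negPf p1) (negPf po).
      move=> l /full_legP/(_ true); rewrite inE /= !xpair_eqE !andbF !orbF.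
      by move/eqP.
    move=> [l c]; rewrite inE /= !xpair_eqE !negb_or => /and3P[li l1 lo].
    have [e1|n1] := eqVneq l i1.
      move: l1; rewrite e1 eqxx /=; case: c {lo} => // _.
      by rewrite /g' mulfVK ?subrr.
    have [eo|no] := eqVneq l o.
      move: lo; rewrite eo eqxx /=; case: c {l1} => // _.
      by rewrite /g' /g kt k11 mul1r subrr sub0r (h0 o) ?mulr0 ?oppr0 // eq_sym.
    by rewrite /g' /g (k0 l) // (k10 l) // (h0 l) // !mulr0 !subr0.
  have := g0 (o, false); rewrite /g' /g (h0 o) 1?eq_sym // mulr0 subr0 mul1r.
  by move/eqP; rewrite subr_eq0 => /eqP.
exists (- k (i, false), - k (i, true)); split; rewrite ?oppr_eq0 //=.
move: kr; rewrite /relation (bigD1 o) //= (bigD1 i) //= big1 => [|l /andP[lo li]].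
  rewrite addr0 kt scale1r ek !scaleNr -opprD => /eqP.
  by rewrite addr_eq0 => /eqP <-; rewrite /t addrC.
by rewrite !k0 // !scale0r addr0.
Qed.

Section Tip.
Variables (t : 'cV[F]_m) (al be : 'I_n -> F).
Hypothesis al_neq0 : forall i, al i != 0.
Hypothesis be_neq0 : forall i, be i != 0.
Hypothesis tE : forall i, t = al i *: w (i, false) + be i *: w (i, true).

(** Expanding [t] on a leg [j] other than [l] turns this into a relation on a set that fills [j] and
    misses [l], hence is independent. *)
Lemma tip_indep (y : {ffun 'I_n -> bool}) l (c : 'I_n -> F) mu :
  c l = 0 -> \sum_i c i *: w (i, y i) + mu *: t = 0 ->
  mu = 0 /\ forall i, c i = 0.
Proof.
move=> cl s0; have [j [jl _ _]] := leg_avoiding3 l l l.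
pose k (e : 'I_n * bool) := (if e.2 == y e.1 then c e.1 else 0) +
  (if e.1 == j then mu * (if e.2 then be j else al j) else 0).
have k0 : forall e, k e = 0.
  apply: (relation_indep
    (P := [set e | (e.1 != l) && ((e.1 == j) || (e.2 == y e.1))])).
  - apply/spike_indepP; left; exists j, l; split=> // [d|i /full_legP f].
      by rewrite inE eqxx.
    have := f (~~ y i); rewrite inE /= => /andP[_ /orP[/eqP //|]].
    by case: (y i).
  - rewrite /relation -[RHS]s0 [X in _ *: X](tE j).
    rewrite (bigD1 j) //= [in RHS](bigD1 j) //= -addrA [in RHS]addrAC /k /= eqxx.
    rewrite (eq_bigr (fun i => c i *: w (i, y i))) => [|i /negPf ij]; last first.
      by rewrite ij !addr0; case: (y i); rewrite /= !scale0r ?addr0 ?add0r.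
    rewrite !addrA; congr (_ + _); rewrite scalerDr !scalerDl !scalerA.
    case: (y j); rewrite /= scale0r ?add0r ?addr0.
      by rewrite addrCA addrA addrC addrA.
    by rewrite addrA.
  - move=> [i d]; rewrite inE /k /= negb_and negbK negb_or.
    case/orP => [/eqP ->|/andP[/negPf -> /negPf ->]]; last by rewrite addr0.
    by rewrite cl if_same eq_sym (negPf jl) addr0.
(* The element of leg [j] off the transversal receives its coefficient from [t] alone. *)
have mu0 : mu = 0.
  have := k0 (j, ~~ y j); rewrite /k /= eqxx.
  case: (y j) => /= /eqP; rewrite add0r mulf_eq0; first by rewrite (negPf (al_neq0 j)) orbF => /eqP.
  by rewrite (negPf (be_neq0 j)) orbF => /eqP.
split=> // i; have := k0 (i, y i); rewrite /k /= eqxx mu0 mul0r if_same.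
by rewrite addr0.
Qed.

(** All the [(i, false)] together with [(j, true)] are dependent, and [t] can replace [(j, true)].
    If some [ka l] vanished, [tip_indep] would make the whole relation trivial. *)
Lemma leg_sum_relation : exists (ka : 'I_n -> F) mu,
  (forall i, ka i != 0) /\ \sum_i ka i *: w (i, false) + mu *: t = 0.
Proof.
have n0 : (0 < n)%N by lia.
pose j := Ordinal n0.
pose P : {set 'I_n * bool} := [set e | ~~ e.2 || (e.1 == j)].
have /relation_dep[k [kr k0 [e0 ke0]]] : P \notin spike_indep D.
  apply/negP => /spike_indepP[[i [l [_ /(_ false)]]]|[x _ eP]].
    by rewrite inE.
  have := transversal_full x j; rewrite -eP; case/negP.
  by apply/full_legP => c; rewrite inE eqxx orbT.
pose mu := k (j, true) / be j.
pose ka i := k (i, false) - (if i == j then mu * al j else 0).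
have s0 : \sum_i ka i *: w (i, false) + mu *: t = 0.
  rewrite -[RHS]kr (tE j) (bigD1 j) //= [in RHS](bigD1 j) //= /ka eqxx.
  rewrite (eq_bigr (fun i => k (i, false) *: w (i, false) + k (i, true) *: w (i, true)))
    => [|i /negPf ij]; last by rewrite ij subr0 (k0 (i, true)) ?scale0r ?addr0 // inE /= ij.
  rewrite addrAC; congr (_ + _); rewrite scalerDr !scalerA mulfVK //.
  by rewrite scalerBl addrA subrK.
exists ka, mu; split=> // l; apply: contra ke0 => /eqP kl.
have [mu0 ka0] : mu = 0 /\ forall i, ka i = 0.
  apply: (@tip_indep [ffun=> false] l) => //; rewrite -[RHS]s0.
  by congr (_ + _); apply: eq_bigr => i _; rewrite ffunE.
have kj : k (j, true) = 0 by rewrite -[LHS](mulfVK (be_neq0 j)) -/mu mu0 mul0r.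
case: e0 => i []; last first.
  by have := ka0 i; rewrite /ka mu0 mul0r if_same subr0 => ->.
have [->|ij] := eqVneq i j; first by rewrite kj.
by rewrite k0 // inE /= (negPf ij).
Qed.

End Tip.

(** Rewriting the relation of [leg_sum_relation] along the transversal [y] changes the coefficient
    of [t] to [rho], and [y] is dependent exactly when [rho] is zero. *)
Lemma dependent_transversals_solutions : exists (d : 'I_n -> F) (s : F),
  forall x, (x \in D) = (\sum_(i | x i) d i == s).
Proof.
have [t [al [be h]]] := exists_tip.
have al0 i : al i != 0 by have [] := h i.
have be0 i : be i != 0 by have [] := h i.
have tE i : t = al i *: w (i, false) + be i *: w (i, true) by have [] := h i.
have [ka [mu [ka0 s0]]] := leg_sum_relation al0 be0 tE.
exists (fun i => ka i / al i), (- mu) => y.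
(* These coefficients arise by expressing [w (i, false)] through [t] and [w (i, true)] wherever
   [y i] is true. *)
pose g i := ka i * (if y i then - (be i / al i) else 1).
pose rho := mu + \sum_(i | y i) ka i / al i.
have g0 i : g i != 0.
  rewrite mulf_neq0 //; case: (y i); rewrite ?oner_neq0 // oppr_eq0.
  by rewrite mulf_neq0 ?invr_neq0.
have sy : \sum_i g i *: w (i, y i) + rho *: t = 0.
  rewrite -[RHS]s0 /rho scalerDl [_ *: t + _]addrC addrA; congr (_ + _).
  rewrite [X in X *: t]big_mkcond scaler_suml -big_split /=; apply: eq_bigr => i _ /=.
  rewrite /g; case: (y i); last by rewrite mulr1 scale0r addr0.
  rewrite (tE i) scalerDr !scalerA mulfVK // addrC -addrA -scalerDl.
  by rewrite mulrN mulrA mulrAC subrr scale0r addr0.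
rewrite -addr_eq0 addrC -/rho; apply/idP/eqP => [|r0].
  (* Given a relation [k] on the transversal, combine it with [sy] so that leg [l] cancels. By
     [tip_indep] the coefficient [k (l, y l) * rho] of [t] is zero, which forces
     [k (l, y l) = 0]. *)
  apply: contraTeq => r0; rewrite -transversal_indep.
  rewrite wD; apply/free_coefP => k k0 ks [l c].
  have kt i d : k (i, d) = if d == y i then k (i, y i) else 0.
    by case: eqP => [-> //|/eqP nd]; rewrite k0 // mem_transversal.
  suff kl : k (l, y l) = 0 by rewrite kt kl if_same.
  have ks' : \sum_i k (i, y i) *: w (i, y i) = 0.
    rewrite -[RHS]ks relation_sum; apply: eq_bigr => i _.
    by rewrite (kt i true) (kt i false); case: (y i); rewrite /= scale0r ?add0r ?addr0.
  have [] := @tip_indep t al be al0 be0 tE y l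
      (fun i => k (l, y l) * g i - g l * k (i, y i)) (k (l, y l) * rho).
  - by rewrite mulrC subrr.
  - rewrite -[RHS](scaler0 _ (k (l, y l))) -[in RHS]sy scalerDr scalerA; congr (_ + _).
    transitivity (k (l, y l) *: \sum_i g i *: w (i, y i)
       - g l *: \sum_i k (i, y i) *: w (i, y i)).
      rewrite !scaler_sumr -sumrB; apply: eq_bigr => i _.
      by rewrite scalerBl !scalerA.
    by rewrite ks' scaler0 subr0.
  - by move=> /eqP; rewrite mulf_eq0 (negPf r0) orbF => /eqP.
apply: contraT; rewrite -transversal_indep wD => /free_coefP ind.
have n0 : (0 < n)%N by lia.
pose k := [ffun e : 'I_n * bool => if e.2 == y e.1 then g e.1 else 0].
have := ind k _ _ (Ordinal n0, y (Ordinal n0)); rewrite ffunE eqxx => h0.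
suff : g (Ordinal n0) = 0 by move/eqP; rewrite (negPf (g0 _)).
apply: h0 => [[i d]|]; first by rewrite mem_transversal ffunE => /negPf ->.
rewrite -[RHS]sy r0 scale0r addr0 relation_sum; apply: eq_bigr => i _.
by rewrite !ffunE /=; case: (y i); rewrite /= scale0r ?add0r ?addr0.
Qed.

End Representation.

(** * Changing one transversal *)

Section SpikesOnGround.
Variables (T : finType) (n : nat) (f : 'I_n * bool -> T).
Hypothesis f_inj : injective f.

Lemma spike_with (D : {set {ffun 'I_n -> bool}}) : 1 < n -> nonadjacent D ->
  exists N : matroid T, ground N = f @: setT /\
    forall P : {set 'I_n * bool}, (f @: P \in indep N) = (P \in spike_indep D).
Proof.
move=> n1 nD.
exists (Matroid (image_matroid_axioms f_inj (spike_matroid_axioms n1 nD))).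
by split=> // P /=; rewrite mem_imset //; apply: imset_inj.
Qed.

Lemma image_preimset (X : {set T}) : X \subset f @: setT -> f @: (f @^-1: X) = X.
Proof.
move=> sX; apply/setP => y; apply/imsetP/idP => [[u]|yX]; first by rewrite inE => ? ->.
by have /imsetP[u _ eu] := subsetP sX _ yX; exists u; rewrite // inE -eu.
Qed.

(** Only the transversal of [x] can be independent in [M] and not in [N]; an [X] properly containing
    it contains another set of the same size that is independent in [N]. The equality of ranks
    follows by symmetry. *)
Lemma rank_le_off_transversal (M N : matroid T) D D' x (X : {set T}) :
  1 < n -> ground M = f @: setT -> X \subset f @: setT ->
  (forall P : {set 'I_n * bool}, (f @: P \in indep M) = (P \in spike_indep D)) ->
  (forall P : {set 'I_n * bool}, (f @: P \in indep N) = (P \in spike_indep D')) ->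
  (forall y, y != x -> (y \in D) = (y \in D')) ->
  X != f @: transversal_of x -> rank M X <= rank N X.
Proof.
move=> n1 gM sXf hM hN DD' nX; apply: rank_leP => I iM sI.
have sIf : I \subset f @: setT by rewrite -gM; apply: indep_ground.
rewrite -(image_preimset sIf) in iM sI *; set P := f @^-1: I in iM sI *.
rewrite hM in iM; have [iN|] := boolP (P \in spike_indep D').
  by apply: card_le_rank => //; rewrite hN.
case/spike_indepP: iM => [h|[y yD eP]].
  by case/negP; apply/spike_indepP; left.
rewrite eP transversal_indep => nyD'.
have eyx : y = x.
  by apply/eqP; apply: contraT => /DD'; rewrite (negPf yD) => yD'; rewrite -yD' in nyD'; case/negP: nyD'.
subst y; rewrite eP in sI *.
have [z zX nz] : exists2 z, z \in X & z \notin f @: transversal_of x.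
  by apply/subsetPn; apply: contra nX => sX; rewrite eqEsubset sX.
have /imsetP[[i c] _ ez] := subsetP sXf _ zX; subst z.
rewrite mem_imset // mem_transversal in nz.
have [j ji] : exists j, j != i.
  have n0 : 0 < n by apply: ltnW.
  exists (if i == Ordinal n0 then Ordinal n1 else Ordinal n0).
  by case: (eqVneq i (Ordinal n0)) => [->|]; rewrite // eq_sym.
(* Exchanging an element of another leg for (i, c) gives a basis in X of a kind
   that does not depend on the dependent transversals. *)
pose B := (i, c) |: (transversal_of x :\ (j, x j)).
have iB : f @: B \in indep N.
  rewrite hN; apply/spike_indepP; left; exists i, j.
  split=> [|d|l fl]; first by rewrite eq_sym.
    by rewrite !inE /= !xpair_eqE (negPf ji) eqxx /=; case: d; case: (x j).
  apply/eqP; apply: contraT => /(full_legU1 fl) /full_legP/(_ (~~ x l)).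
  by rewrite !inE /=; case: (x l); rewrite andbF.
have sB : f @: B \subset X.
  rewrite imsetU1 subUset sub1set zX /=; apply: subset_trans sI.
  by apply/imsetS/subD1set.
apply: leq_trans (card_le_rank iB sB); rewrite !card_imset // cardsU1.
rewrite (cardsD1 (j, x j) (transversal_of x)) mem_transversal eqxx.
by rewrite !inE /= negb_and nz orbT.
Qed.

Lemma rank_off_transversal (M N : matroid T) D D' x (X : {set T}) :
  1 < n -> ground M = f @: setT -> ground N = f @: setT -> X \subset f @: setT ->
  (forall P : {set 'I_n * bool}, (f @: P \in indep M) = (P \in spike_indep D)) ->
  (forall P : {set 'I_n * bool}, (f @: P \in indep N) = (P \in spike_indep D')) ->
  (forall y, y != x -> (y \in D) = (y \in D')) ->
  X != f @: transversal_of x -> rank N X = rank M X.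
Proof.
move=> n1 gM gN sX hM hN DD' nX; apply/eqP; rewrite eqn_leq.
rewrite (rank_le_off_transversal (D := D') (D' := D) (x := x)) //=; last first.
  by move=> y /DD'.
exact: (rank_le_off_transversal (D := D) (D' := D') (x := x)).
Qed.

Lemma representable_solutions (F : finFieldType) (N : matroid T) D :
  3 < n -> ground N = f @: setT ->
  (forall P : {set 'I_n * bool}, (f @: P \in indep N) = (P \in spike_indep D)) ->
  representable F N ->
  exists (d : 'I_n -> F) (s : F), forall x, (x \in D) = (\sum_(i | x i) d i == s)%R.
Proof.
move=> n3 gN hN [m [v hv]].
apply: (@dependent_transversals_solutions F n m (v \o f)) => // P.
rewrite -hN hv ?gN ?imsetS ?subsetT //; apply: perm_free.
rewrite /image_mem (map_comp v f).
apply: perm_map; apply: uniq_perm.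
- exact: enum_uniq.
- by rewrite map_inj_uniq ?enum_uniq.
- move=> y; rewrite mem_enum; apply/imsetP/mapP => -[u uP ->]; exists u => //.
    by rewrite mem_enum.
  by rewrite mem_enum in uP.
Qed.

End SpikesOnGround.

(** * The size of a certificate *)

Lemma spike_certificate_card (F : finFieldType) (T : finType) (n : nat)
    (M : matroid T) (Xs : {set {set T}}) :
  #|F| ^ 3 < n -> spike n M -> (forall X, X \in Xs -> X \subset ground M) ->
  (forall N : matroid T, ground N = ground M ->
     (forall X : {set T}, X \in Xs -> rank N X = rank M X) -> representable F N) ->
  2 ^ n <= #|Xs| * 2 ^ #|F|.
Proof.
move=> ltn spM sXs cert.
have q1 : 1 < #|F| by apply: card_finNzRing_gt1.
have n3 : 3 < n.
  apply: leq_trans ltn; apply: (@leq_trans (2 ^ 3).+1) => //.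
  by rewrite ltnS leq_exp2r.
have n1 : 1 < n by lia.
have [f [D [f_inj nD gM hM]]] := spike_structure spM.
have ltI : #|F| ^ 3 < #|'I_n| by rewrite card_ord.
have tr_inj : injective (fun x => f @: @transversal_of n x).
  by move=> x y /(imset_inj f_inj)/transversal_inj.
(* If the certificate omits the transversal of [x], it cannot separate [M] from the spike of [D'],
   so that spike is representable as well. *)
have altered D' x : nonadjacent D' -> (forall y, y != x -> (y \in D) = (y \in D')) ->
    f @: transversal_of x \notin Xs ->
    exists (d : 'I_n -> F) s, forall y, (y \in D') = (\sum_(i | y i) d i == s)%R.
  move=> nD' DD' xXs; have [N [gN hN]] := spike_with f_inj n1 nD'.
  apply: (representable_solutions f_inj n3 gN hN).
  apply: cert => [|X XXs]; first by rewrite gN gM.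
  apply: (rank_off_transversal f_inj n1 gM gN _ hM hN DD').
    by rewrite -gM sXs.
  by apply: contraNneq xXs => <-.
have bound (D' : {set {ffun 'I_n -> bool}}) :
    (forall x, x \in D' -> f @: transversal_of x \in Xs) -> #|D'| <= #|Xs|.
  move=> h; rewrite -(card_imset _ tr_inj); apply: subset_leq_card.
  by apply/subsetP => X /imsetP[x xD' ->]; apply: h.
have [D0|/set0Pn[x0 x0D]] := eqVneq D set0.
  apply: (@leq_trans #|Xs|); last by rewrite leq_pmulr ?expn_gt0.
  have := bound setT; rewrite cardsT card_ffun card_bool card_ord; apply=> x _.
  apply: contraT => /(altered [set x]) [x1 i|y /negPf yx|d [s hd]].
  - rewrite !inE => /eqP ->; apply/eqP => /ffunP/(_ i); rewrite ffunE inE eqxx.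
    by case: (x i).
  - by rewrite D0 !inE yx.
  (* Only the system of the altered spike has to be preserved here, so [d] is passed twice. *)
  - have [y [yx ey _]] := equal_sums_flip d d x ltI.
    by move: yx; rewrite -in_set1 hd ey -hd inE eqxx.
have [d [s hd]] := representable_solutions f_inj n3 gM hM (cert M erefl (fun _ _ => erefl)).
apply: (@leq_trans (#|D| * 2 ^ #|F|)).
  have := x0D; rewrite hd => /eqP /card_sum_solutions; rewrite card_ord.
  suff -> : D = [set x : {ffun _ -> _} | (\sum_(i | x i) d i)%R == s] by [].
  by apply/setP => x; rewrite inE hd.
rewrite leq_mul2r bound ?orbT // => x xD.
apply: contraT => /(altered (D :\ x)) [x1 i|y yx|d' [s' hd']].
- by rewrite !inE negb_and => /andP[_ /(nD x1 i) ->]; rewrite orbT.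
- by rewrite !inE yx.
- have [y [yx ey ey']] := equal_sums_flip d d' x ltI.
  have : x \in D :\ x by rewrite hd' -ey' -hd' !inE yx hd ey -hd.
  by rewrite !inE eqxx.
Qed.

Local Open Scope ring_scope.

Theorem theorem2p1 (R : realType) (q : nat)
    (hq : exists p k : nat, [/\ prime p, (0 < k)%N & q = (p ^ k)%N])
    (F : finFieldType) (hF : #|F| = q)
    (T : finType) (n : nat) (hn : (q ^ 3 < n)%N)
    (M : matroid T) (hM : spike n M)
    (Xs : {set {set T}}) (hXs : forall X : {set T}, X \in Xs -> X \subset ground M)
    (hcert : forall N : matroid T, ground N = ground M ->
       (forall X : {set T}, X \in Xs -> rank N X = rank M X) ->
       representable F N) :
  (2 : R) `^ (n%:R / 2) <= #|Xs|%:R.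
Proof.
have h : (2 ^ n <= #|Xs| * 2 ^ q)%N.
  by rewrite -hF; apply: spike_certificate_card hM hXs hcert; rewrite hF.
have q1 : (1 < q)%N by rewrite -hF; apply: card_finNzRing_gt1.
(* Since [q ^ 2 >= q >= 2], [2 * q <= q ^ 3 < n]; this makes the exponent [n - q] at least
   [n / 2]. *)
have qn : (2 * q <= n)%N.
  apply: leq_trans (ltnW hn); rewrite expnS mulnC leq_mul2l.
  by rewrite (leq_trans q1) ?orbT // -[leqLHS]expn1 leq_pexp2l // ltnW.
have h' : (2 ^ (n - q) <= #|Xs|)%N.
  by rewrite -(@leq_pmul2r (2 ^ q)) ?expn_gt0 // -expnD subnK //; lia.
apply: (@le_trans _ _ (2 `^ (n - q)%:R)).
  apply: ler_powR; first by rewrite ler1n.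
  rewrite ler_pdivrMr // -natrM ler_nat; lia.
by rewrite powR_mulrn // -natrX ler_nat.
Qed.
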